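(* Let $\alpha>0$ be an arbitrary constant, let $\beta>1$, and let $b\in C^1(\mathbb{R},[\beta,\infty))$ satisfy $|b(t_1)-b(t_2)|\le L_b|t_1-t_2|$ for all $t_1,t_2\in\mathbb{R}$, with a constant $L_b\ge 0$. Let $\bar B_1\subset\mathbb{R}^2$ be the closed ball of radius $1$ centered at $(-1.5,0)$, and for $t\in\mathbb{R}$ set $$C(t)=\bar B_1\cap S(t),\qquad S(t)=\left\{x=(x_1,x_2)\in\mathbb{R}^2:\ x_1^2+\frac{x_2^2}{b(t)^2}\ge 1\right\},\qquad f(t,x)=\alpha x .$$ If $$\alpha>\frac{\dfrac{4L_b}{3\beta^3}+\dfrac52\alpha}{\left(\beta^{4/3}-\beta^{-2/3}\right)^{3/2}},$$ then the global solution $x(t)=(-1,0)$, $t\in\mathbb{R}$, of the sweeping process $$-\dot x\in N(C(t),x)+f(t,x)$$ is globally asymptotically stable.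
   Context: Norms are Euclidean. For a closed set $C\subset\mathbb{R}^2$, $\mathrm{proj}(y,C)$ is the set of points of $C$ closest to $y$. For $x\in C$ the (proximal) normal cone is $N(C,x)=\{v\in\mathbb{R}^2:\ x\in\mathrm{proj}(x+av,C)\text{ for some }a>0\}$. A solution of the sweeping process on an interval $I\subset\mathbb{R}$ is a function $x:I\to\mathbb{R}^2$, absolutely continuous (on compact subintervals of $I$), such that $x(t)\in C(t)$ for all $t\in I$ and $-\dot x(t)\in N(C(t),x(t))+f(t,x(t))$ for a.e. $t\in I$. A global solution is a solution on $I=\mathbb{R}$. A global solution $x_0$ is globally asymptotically stable if (i) for every $\tau\in\mathbb{R}$ and $\varepsilon>0$ there is $\delta>0$ such that every solution $x$ on $[\tau,\infty)$ with $\|x(\tau)-x_0(\tau)\|<\delta$ satisfies $\|x(t)-x_0(t)\|<\varepsilon$ for all $t\ge\tau$; and (ii) for every $\tau\in\mathbb{R}$, every solution $x$ on $[\tau,\infty)$ satisfies $\|x(t)-x_0(t)\|\to 0$ as $t\to\infty$. *)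

(* Defs.v *)
From HB Require Import structures.
From mathcomp Require Import all_boot all_order all_algebra.
From mathcomp Require Import all_classical all_reals all_analysis.

Set Implicit Arguments.
Unset Strict Implicit.
Unset Printing Implicit Defensive.

Import Order.TTheory GRing.Theory Num.Theory.
Import numFieldNormedType.Exports.

Local Open Scope classical_set_scope.
Local Open Scope ring_scope.

Section SweepingProcess.
Context {R : realType}.
Local Notation plane := 'rV[R]_2.

Definition pt (x1 x2 : R) : plane := \row_i (if i == 0 then x1 else x2).

(* The library's norm `|x| on row vectors is the sup norm, hence a separate
   Euclidean one; both induce the same topology and derivatives. *)
Definition enorm (x : plane) : R := Num.sqrt (\sum_i x 0 i ^+ 2).

Definition proj (y : plane) (C : set plane) : set plane :=
  [set x : plane | C x /\ forall z, C z -> enorm (y - x) <= enorm (y - z)].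

Definition normal_cone (C : set plane) (x : plane) : set plane :=
  [set v : plane | exists2 a : R, 0 < a & proj (x + a *: v) C x].

Definition absolutely_continuous (a b : R) (x : R -> plane) : Prop :=
  forall e : R, 0 < e -> exists2 d : R, 0 < d &
    forall (n : nat) (s t : 'I_n -> R),
      (forall i, [/\ a <= s i, s i <= t i & t i <= b]) ->
      trivIset [set: 'I_n] (fun i => `]s i, t i[%classic) ->
      \sum_i (t i - s i) < d ->
      \sum_i enorm (x (t i) - x (s i)) < e.

(* x is a total function, but only its values on I matter: the derivative at an
   endpoint of I would involve values outside I, and the endpoints are
   negligible. *)
Definition sweeping_solution (C : R -> set plane) (f : R -> plane -> plane)
    (I : interval R) (x : R -> plane) : Prop :=
  [/\ forall a b : R, a <= b -> [set` `[a, b]] `<=` [set` I] ->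
        absolutely_continuous a b x,
      forall t : R, t \in I -> C t (x t) &
      {ae lebesgue_measure, forall t : R, t \in I ->
        derivable x t 1 /\
        [set v + f t (x t) | v in normal_cone (C t) (x t)] (- derive1 x t)}].

Definition global_solution (C : R -> set plane) (f : R -> plane -> plane)
    (x : R -> plane) : Prop := sweeping_solution C f `]-oo, +oo[ x.

Definition globally_asymptotically_stable (C : R -> set plane)
    (f : R -> plane -> plane) (x0 : R -> plane) : Prop :=
  (forall tau eps : R, 0 < eps -> exists2 delta : R, 0 < delta &
     forall x : R -> plane, sweeping_solution C f `[tau, +oo[ x ->
       enorm (x tau - x0 tau) < delta ->
       forall t : R, tau <= t -> enorm (x t - x0 t) < eps) /\
  (forall (tau : R) (x : R -> plane), sweeping_solution C f `[tau, +oo[ x ->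
     enorm (x t - x0 t) @[t --> +oo] --> (0 : R)).

Definition ball1 : set plane := [set x : plane | enorm (x - pt (- (3 / 2)) 0) <= 1].

Definition ellipse_exterior (b : R -> R) (t : R) : set plane :=
  [set x : plane | x 0 0 ^+ 2 + x 0 1 ^+ 2 / b t ^+ 2 >= 1].

Definition moving_set (b : R -> R) (t : R) : set plane :=
  ball1 `&` ellipse_exterior b t.

End SweepingProcess.

(* Main.v *)
Require Import Defs.
From HB Require Import structures.
From mathcomp Require Import all_boot all_order all_algebra.
From mathcomp Require Import all_classical all_reals all_analysis.
From mathcomp Require Import ring lra.

Import Order.TTheory GRing.Theory Num.Theory.
Import numFieldNormedType.Exports.

Local Open Scope classical_set_scope.
Local Open Scope ring_scope.

(* Put W = |x - x0|^2 along a solution x.  The hypothesis forces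
   beta^2 > 7/2 and 4 Lb / (3 beta^3) + 5/2 alpha <= alpha (beta^2 - 1), since
   (beta^(4/3) - beta^(-2/3))^(3/2) = (beta^2 - 1)^(3/2) / beta <= beta^2 - 1.
   At almost every t the velocity x' is tangent to each active constraint.
   - The circle is never active: an inward step from it is feasible, hence makes
     a nonpositive product with the normal vector, while tangency gives that
     product the opposite sign, because the points of C(t) satisfy x_1 < -5/6.
   - On the ellipse the normal vector is parallel to the gradient of the
     constraint, and tangency to the moving ellipse gives its length.  As
     (x0 - x) has the product (1 + x_1) with the gradient, while
     W = (1 + x_1) ((1 + x_1) + b^2 (1 - x_1)) there, W' <= - (alpha / 2) W.
   - Inside C(t) the normal vector is 0 and the same inequality holds.
   Absolute continuity turns this into monotonicity of W (stability), and W
   cannot stay above a positive level (attraction). *)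

(** * Mean value inequality for absolutely continuous functions *)

Lemma derive_approx (R : realType) (f : R -> R) (t : R) (df : derivable f t 1)
    (e : R) (e_gt0 : 0 < e) :
  exists2 d : R, 0 < d &
    forall s : R, `|s - t| < d -> `|f s - f t - 'D_1 f t * (s - t)| <= e * `|s - t|.
Proof.
have /cvgrPdist_le/(_ _ e_gt0) := df.
rewrite -/('D_1 f t).
move=> [d /= d0 H]; exists d => // s sd.
have [->|st] := eqVneq s t; first by rewrite !subrr mulr0 subrr !normr0 mulr0.
have st0 : s - t != 0 by rewrite subr_eq0.
have := H (s - t); rewrite /= sub0r normrN => /(_ sd st0).
rewrite [_%:A]mulr1 subrK /derive.
set L := lim _.
move=> h.
have -> : f s - f t - L * (s - t) = - ((s - t) * (L - (s - t)^-1 * (f s - f t))).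
  by field.
by rewrite normrN normrM mulrC ler_wpM2r.
Qed.

(** Outer regularity at a measurable null set [A] containing [N]: the open set exceeds [A] by
    measure less than [d], and [A] itself adds nothing. *)
Lemma open_cover_negligible (R : realType) (N : set R) (d : R) :
  lebesgue_measure.-negligible N -> 0 < d ->
  exists U : set R, [/\ open U, N `<=` U & (lebesgue_measure U < d%:E)%E].
Proof.
move=> [A [mA muA NA]] d_gt0.
have muAoo : (lebesgue_measure A < +oo)%E by rewrite muA.
have [U [oU AU UA]] := lebesgue_regularity_outer mA muAoo d_gt0.
exists U; split => //; first exact: subset_trans AU.
have mU : measurable U by exact: measurable_realfun.open_measurable.
rewrite -(setDUK AU); apply: le_lt_trans UA.
rewrite (le_trans (measureU2 _ _ _)) //; first exact: measurableD.
by rewrite [X in (X + _)%E]muA add0e.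
Qed.

(** Disjointness turns the sum of lengths into the measure of the union. This makes intervals inside
    a small open cover admissible for absolute continuity. *)
Lemma sum_length_lt (R : realType) (U : set R) (d : R) (n : nat) (s t : 'I_n -> R) :
  open U -> (lebesgue_measure U < d%:E)%E ->
  (forall i, s i <= t i) -> (forall i, `]s i, t i[%classic `<=` U) ->
  trivIset [set: 'I_n] (fun i => `]s i, t i[%classic) ->
  \sum_i (t i - s i) < d.
Proof.
move=> oU Ud st stU dis.
have mst : measurable (\big[setU/set0]_(i < n) `]s i, t i[%classic).
  by apply: bigsetU_measurable => i _; exact: measurable_itv.
rewrite -lte_fin; apply: le_lt_trans Ud.
have -> : ((\sum_i (t i - s i))%:E = lebesgue_measure
    (\big[setU/set0]_(i < n) `]s i, t i[%classic : set R))%E.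
  transitivity (\sum_(i < n) lebesgue_measure (`]s i, t i[%classic : set R))%E; last first.
    by exact/esym/measure_semi_additive_ord.
  rewrite -sumEFin; apply: eq_bigr => i _.
  rewrite [RHS]lebesgue_measure_itv/= lte_fin; case: ltgtP (st i) => // -> _.
  by rewrite subrr.
apply: le_measure; rewrite ?inE//; first exact: measurable_realfun.open_measurable.
by rewrite -bigcup_seq => x [i _]; exact: stU.
Qed.

(** At the supremum [c] of the points satisfying [P], the local step starts just below [c] and
    passes beyond it, which is absurd unless it already reaches [b]. *)
Lemma real_induction (R : realType) (a b : R) (P : R -> Prop) : a <= b -> P a ->
  (forall c, a <= c <= b -> exists2 d : R, 0 < d &
     forall s t, a <= s -> t <= b -> c - d < s -> t < c + d -> s <= c <= t ->
       P s -> P t) ->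
  P b.
Proof.
move=> ab Pa loc.
pose S := [set t | a <= t <= b /\ P t].
have Sa : S a by split; rewrite ?lexx.
have Sub : ubound S b by move=> t [/andP[]].
have Ssup : has_sup S by split; [exists a|exists b].
set c := sup S.
have ac : a <= c by apply: ub_le_sup => //; exists b.
have cb : c <= b by apply: ge_sup => //; exists a.
have [|d d0 H] := loc c; first by rewrite ac.
have [s [/andP[as_ sb] Ps] cds] := sup_adherent d0 Ssup.
have sc : s <= c by apply: ub_le_sup; [exists b|split; rewrite ?as_].
have [cdb|bcd] := leP (c + d / 2) b; last first.
  have [//|cltb] := leP (c + d) b; last by apply: H Ps => //; rewrite sc.
  lra.
have : S (c + d / 2).
  split; first by apply/andP; split=> //; lra.
  by apply: H Ps => //; last (apply/andP; split=> //); lra.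
move=> Scd; have : c + d / 2 <= c by apply: ub_le_sup => //; exists b.
by move=> ?; exfalso; lra.
Qed.

(* The right endpoints are listed increasingly, so that a new interval can be
   appended at the end and the family stays disjoint. *)
Lemma ac_mean_value_aux (R : realType) (g : R -> R) (a b k : R) (U : set R) : a <= b ->
  open U ->
  (forall c, a <= c <= b -> U c \/
     [/\ derivable g c 1 & 'D_1 g c < k]) ->
  exists (n : nat) (s t : 'I_n -> R),
    [/\ forall i, [/\ a <= s i, s i <= t i & t i <= b],
        trivIset [set: 'I_n] (fun i => `]s i, t i[%classic),
        forall i, `]s i, t i[%classic `<=` U &
        g b - g a <= k * (b - a) + \sum_i (g (t i) - g (s i) - k * (t i - s i))].
Proof.
move=> ab oU bad.
pose P c := exists (n : nat) (s t : nat -> R),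
    [/\ forall i, (i < n)%N -> [/\ a <= s i, s i <= t i & t i <= c],
        forall i j, (i < j)%N -> (j < n)%N -> t i <= s j,
        forall i, (i < n)%N -> `]s i, t i[%classic `<=` U &
        g c - g a <= k * (c - a) + \sum_(i < n) (g (t i) - g (s i) - k * (t i - s i))].
suff [n [s [t [h1 h2 h3 h4]]]] : P b.
  exists n, (fun i => s i), (fun i => t i); split => //.
  - by move=> i; exact: h1.
  - apply/trivIsetP => i j _ _; wlog ij : i j / (i < j)%N => [W|] nij.
      have [/W->//|/W|/val_inj ?] := ltngtP i j; last by subst j; rewrite eqxx in nij.
      by rewrite setIC; apply; rewrite eq_sym.
    apply/seteqP; split => // x [/=]; rewrite !in_itv/= => /andP[_ xt] /andP[sx _].
    by have := h2 i j ij (ltn_ord j); rewrite leNgt (lt_trans sx xt).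
  - by move=> i; exact: h3.
apply: (@real_induction R a b) => //.
  by exists 0%N, (fun=> a), (fun=> a); split => //; rewrite big_ord0 !subrr mulr0 addr0.
(* Across an interval inside [U] the increment of [g] is recorded exactly, by appending []p, q[] to
   the family. *)
have stepU p q : a <= p -> p <= q -> `]p, q[%classic `<=` U -> P p -> P q.
  move=> ap pq pqU [n [s [t [h1 h2 h3 h4]]]].
  exists n.+1, (fun i => if i == n then p else s i), (fun i => if i == n then q else t i).
  split.
  - move=> i; rewrite ltnS leq_eqVlt; case: eqP => //= _ /h1[? ? ?]; split => //.
    exact: le_trans pq.
  - move=> i j ij; rewrite ltnS leq_eqVlt; case: (eqVneq j n) => //= [jn _|_ jn].
      by subst j; rewrite (ltn_eqF ij); have [] := h1 i ij.
    by rewrite (ltn_eqF (ltn_trans ij jn)) h2.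
  - by move=> i; rewrite ltnS leq_eqVlt; case: eqP => //= _ /h3.
  - rewrite big_ord_recr/= eqxx.
    under eq_bigr do rewrite (ltn_eqF (ltn_ord _)).
    by lra.
(* Where [g] grows at mean rate at most [k], the family is left unchanged. *)
have stepk p q : p <= q -> g q - g p <= k * (q - p) -> P p -> P q.
  move=> pq gpq [n [s [t [h1 h2 h3 h4]]]]; exists n, s, t; split => //.
    by move=> i /h1[? ? ?]; split => //; exact: le_trans pq.
  by lra.
move=> c /[dup] /andP[ac cb] /bad[Uc|[dgc Dk]].
  have /nbhs_ballP[d /= d0 dU] : nbhs c U by move: oU; rewrite openE; exact.
  exists d => // s t as_ tb cds tcd /andP[sc ct].
  apply: stepU => //; first exact: le_trans ct.
  move=> x /=; rewrite in_itv/= => /andP[sx xt]; apply: dU => /=.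
  by rewrite /ball/= ltr_distlC; apply/andP; split; lra.
(* With the slack [k - 'D_1 g c] as error, the chords of [g] from [c] to either side have slope at
   most [k]. *)
have e0 : 0 < k - 'D_1 g c by rewrite subr_gt0.
have [d d0 gd] := derive_approx _ _ _ dgc _ e0.
exists d => // s t as_ tb cds tcd /andP[sc ct].
apply: stepk; first exact: le_trans ct.
have : g t - g c <= k * (t - c).
  have := gd t; have -> : `|t - c| = t - c by rewrite ger0_norm ?subr_ge0.
  move=> /(_ ltac:(lra)).
  by rewrite ler_norml => /andP[_]; lra.
have : g c - g s <= k * (c - s).
  have := gd s; have -> : `|s - c| = c - s by rewrite distrC ger0_norm ?subr_ge0.
  move=> /(_ ltac:(lra)).
  by rewrite ler_norml => /andP[]; lra.
lra.
Qed.

(** The exceptional times are covered by an open set of small measure. On disjoint intervals inside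
    it, absolute continuity of [x] makes the total increment of [g] small. *)
Lemma ac_mean_value (R : realType) (x : R -> 'rV[R]_2) (g : R -> R) (a b K k : R) :
  a <= b -> absolutely_continuous a b x ->
  (forall s t, a <= s <= b -> a <= t <= b ->
     `|g t - g s| <= K * enorm (x t - x s)) ->
  {ae lebesgue_measure, forall t, a < t < b ->
     derivable g t 1 /\ 'D_1 g t <= k} ->
  g b - g a <= k * (b - a).
Proof.
move=> ab acx gK aeg.
(* Raising [k] to [k + e] gives the strict derivative bound required by the covering lemma. *)
suff H e : 0 < e -> g b - g a <= (k + e) * (b - a) + e.
  apply/ler_addgt0Pr => e e0.
  have c0 : 0 < b - a + 1 by lra.
  have := H (e / (b - a + 1)) (divr_gt0 e0 c0).
  set z := e / _; have -> : e = z * (b - a + 1) by rewrite /z; field; lra.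
  lra.
move=> e0.
set k' := k + e.
have K0 : 0 < `|K| + 1 by have := normr_ge0 K; lra.
have k0 : 0 < `|k'| + 1 by have := normr_ge0 k'; lra.
(* The increments of [g] and the lengths weighted by [k'] each get a budget [e / 2]; the [+ 1] keeps
   the divisors positive. *)
have [d d0 acd] := acx (e / 2 / (`|K| + 1)) ltac:(by rewrite !divr_gt0).
pose d' := Num.min d (e / 2 / (`|k'| + 1)).
have d'0 : 0 < d' by rewrite lt_min d0 !divr_gt0.
have negl : lebesgue_measure.-negligible
    (~` [set t | a < t < b -> derivable g t 1 /\ 'D_1 g t <= k] `|` ([set a] `|` [set b])).
  apply: negligibleU; first exact: aeg.
  by apply: negligibleU; apply/negligibleP => //; exact: lebesgue_measure_set1.
have [U [oU NU Ud]] := open_cover_negligible _ _ _ negl d'0.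
have [|n [s [t [st dis stU gba]]]] := ac_mean_value_aux _ g a b k' U ab oU.
  move=> c /andP[ac cb].
  have [?|nUc] := pselect (U c); [by left|right].
  have /not_orP[/contrapT Hc /not_orP[/= cNa cNb]] := contra_not (@NU c) nUc.
  have [] := Hc.
    by rewrite !lt_neqAle ac cb !andbT; apply/andP; split; apply/eqP => // /esym.
  by move=> ? ?; split => //; rewrite /k'; lra.
have := sum_length_lt _ _ _ _ s t oU Ud (fun i => let: And3 _ h _ := st i in h) stU dis.
rewrite lt_min => /andP[sd sk].
have := acd n s t st dis sd; set A := (X in X < _) => Ae.
apply: le_trans gba _; rewrite lerD2l sumrB -mulr_sumr.
set S := (X in X - _); set L := \sum_i (t i - s i) in sk *.
have SA : S <= (`|K| + 1) * A.
  rewrite /S /A mulr_sumr; apply: ler_sum => i _.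
  have [? ? ?] := st i.
  apply: le_trans (ler_norm _) _; apply: le_trans (gK _ _ _ _) _.
  - by apply/andP; split => //; lra.
  - by apply/andP; split => //; lra.
  - by apply: ler_wpM2r; [exact: sqrtr_ge0|have := ler_norm K; lra].
have L0 : 0 <= L by apply: sumr_ge0 => i _; have [? ? ?] := st i; lra.
have kL : - (k' * L) <= (`|k'| + 1) * L.
  by rewrite -mulNr ler_wpM2r//; have := ler_norm (- k'); rewrite normrN; lra.
move: Ae sk; rewrite !ltr_pdivlMr// ![_ * (`|_| + 1)]mulrC; lra.
Qed.

(** * Derivatives at maxima and under a Lipschitz bound *)

(** Fermat's rule. An active constraint function is maximal along the solution, so this yields
    tangency of the velocity. *)
Lemma derive_local_max (R : realType) (f : R -> R) (t d : R) :
  derivable f t 1 -> 0 < d -> (forall s, `|s - t| < d -> f s <= f t) ->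
  'D_1 f t = 0.
Proof.
move=> df d0 fmax; apply/eqP; rewrite -normr_le0; apply/ler_addgt0Pr => e e0.
have [r r0 fr] := derive_approx _ _ _ df _ e0.
set m := Num.min d r / 2.
have m0 : 0 < m by rewrite divr_gt0// lt_min d0.
have [md mr] : m < d /\ m < r.
  have : Num.min d r <= d /\ Num.min d r <= r by rewrite !ge_min !lexx orbT.
  by move: m0; rewrite /m; lra.
rewrite add0r ler_norml.
have ap : `|t + m - t| = m by rewrite addrAC subrr add0r gtr0_norm.
have am : `|t - m - t| = m by rewrite addrAC subrr add0r normrN gtr0_norm.
have := fr (t + m); rewrite ap => /(_ mr); have := fmax (t + m); rewrite ap => /(_ md).
have := fr (t - m); rewrite am => /(_ mr); have := fmax (t - m); rewrite am => /(_ md).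
rewrite !ler_norml => h1 /andP[h2 h3] h4 /andP[h5 h6].
by apply/andP; split; rewrite -(ler_pM2r m0); lra.
Qed.

Lemma derive_lipschitz (R : realType) (f : R -> R) (t L : R) :
  derivable f t 1 -> (forall s, `|f s - f t| <= L * `|s - t|) -> `|'D_1 f t| <= L.
Proof.
move=> df fL; apply/ler_addgt0Pr => e e0.
have [r r0 fr] := derive_approx _ _ _ df _ e0.
have m0 : 0 < r / 2 by lra.
have ap : `|t + r / 2 - t| = r / 2 by rewrite addrAC subrr add0r gtr0_norm.
have := fr (t + r / 2); rewrite ap => /(_ ltac:(lra)).
have := fL (t + r / 2); rewrite ap.
have -> : t + r / 2 - t = r / 2 by ring.
rewrite !ler_norml => /andP[h1 h2] /andP[h3 h4].
by apply/andP; split; rewrite -(ler_pM2r m0); lra.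
Qed.

(** * Euclidean norm and constraints in coordinates *)

Lemma sqr_enorm (R : realType) (x : 'rV[R]_2) : enorm x ^+ 2 = x 0 0 ^+ 2 + x 0 1 ^+ 2.
Proof.
rewrite /enorm sqr_sqrtr; last by apply: sumr_ge0 => i _; exact: sqr_ge0.
by rewrite big_ord_recl big_ord1; congr (_ + x _ _ ^+ 2); apply/val_inj.
Qed.

Lemma enorm_ge0 (R : realType) (x : 'rV[R]_2) : 0 <= enorm x.
Proof. exact: sqrtr_ge0. Qed.

Lemma ler_enorm (R : realType) (x y : 'rV[R]_2) :
  (enorm x <= enorm y) = (x 0 0 ^+ 2 + x 0 1 ^+ 2 <= y 0 0 ^+ 2 + y 0 1 ^+ 2).
Proof. by rewrite -!sqr_enorm ler_pXn2r// nnegrE enorm_ge0. Qed.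

Lemma normr_le_enorm (R : realType) (x : 'rV[R]_2) :
  `|x 0 0| <= enorm x /\ `|x 0 1| <= enorm x.
Proof.
by split; rewrite -(@ler_pXn2r _ 2)// ?nnegrE ?enorm_ge0// sqr_enorm real_normK ?num_real//
  ?lerDl ?lerDr sqr_ge0.
Qed.

Lemma ptE (R : realType) (p q : R) : (pt p q 0 0 = p) * (pt p q 0 1 = q).
Proof. by rewrite /pt !mxE. Qed.

Lemma ball1E (R : realType) (x : 'rV[R]_2) :
  ball1 x <-> (x 0 0 + 3 / 2) ^+ 2 + x 0 1 ^+ 2 <= 1.
Proof.
rewrite /ball1/= -(@ler_pXn2r _ 2) ?nnegrE ?enorm_ge0// sqr_enorm expr1n.
by rewrite !mxE/= opprK subr0.
Qed.

(* Clearing the denominator makes the constraint polynomial in [x] and [b t]. *)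
Lemma ellipse_exteriorE (R : realType) (b : R -> R) (t : R) (x : 'rV[R]_2) :
  0 < b t ->
  ellipse_exterior b t x <-> b t ^+ 2 <= b t ^+ 2 * x 0 0 ^+ 2 + x 0 1 ^+ 2.
Proof.
move=> b0; rewrite /ellipse_exterior/= -(ler_pM2l (exprn_gt0 2 b0)) mulr1.
by rewrite mulrDr [X in _ + X]mulrC divfK// expf_neq0// gt_eqF.
Qed.

(** * Normal cone and feasible directions *)

(** If the product [m] were positive, a short step along [d] would come closer to [x + a *: v] than
    [x] is. *)
Lemma normal_cone_feasible_direction (R : realType) (C : set 'rV[R]_2)
    (x v d : 'rV[R]_2) (s0 : R) :
  normal_cone C x v -> 0 < s0 -> (forall s, 0 < s -> s <= s0 -> C (x + s *: d)) ->
  v 0 0 * d 0 0 + v 0 1 * d 0 1 <= 0.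
Proof.
move=> [a a0 [_ xmin]] s00 Cd.
set m := _ + _; rewrite leNgt; apply/negP => m0.
pose D := d 0 0 ^+ 2 + d 0 1 ^+ 2.
have D0 : 0 <= D by rewrite addr_ge0 ?sqr_ge0.
(* For this step [s * D < a * m], so the first-order gain [2 * a * m * s] beats the second-order
   loss [s ^+ 2 * D]. *)
pose s := Num.min s0 (a * m / (D + 1)).
have D1 : 0 < D + 1 by lra.
have am : 0 < a * m by rewrite mulr_gt0.
have s_gt0 : 0 < s by rewrite lt_min s00 divr_gt0.
have : s <= a * m / (D + 1) by rewrite ge_min lexx orbT.
rewrite ler_pdivlMr// => sD.
have := xmin _ (Cd s s_gt0 ltac:(by rewrite ge_min lexx)).
rewrite ler_enorm !mxE => h.
have {}h : 2 * (a * m) * s <= s * D * s by rewrite /m /D; lra.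
by move: h; rewrite ler_pM2r//; lra.
Qed.

Lemma affine_pos_near0 (R : realType) (r m : R) : 0 < r ->
  exists2 s0 : R, 0 < s0 & forall s, 0 < s -> s <= s0 -> s * m <= r.
Proof.
move=> r0; have m0 : 0 < `|m| + 1 by have := normr_ge0 m; lra.
exists (r / (`|m| + 1)); first by rewrite divr_gt0.
move=> s s0; rewrite ler_pdivlMr// => sr; apply: le_trans sr.
by apply: ler_wpM2l; [exact: ltW|have := ler_norm m; lra].
Qed.

Lemma ball_feasible (R : realType) (p q d1 d2 : R) :
  (p + 3 / 2) ^+ 2 + q ^+ 2 < 1 ->
  exists2 s0 : R, 0 < s0 & forall s, 0 < s -> s <= s0 ->
    (p + s * d1 + 3 / 2) ^+ 2 + (q + s * d2) ^+ 2 <= 1.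
Proof.
move=> pq1.
have r0 : 0 < 1 - ((p + 3 / 2) ^+ 2 + q ^+ 2) by lra.
have [s0 s00 H] := affine_pos_near0 _ _
  (2 * ((p + 3 / 2) * d1 + q * d2) + (d1 ^+ 2 + d2 ^+ 2)) r0.
(* Keeping [s <= 1] lets the quadratic term be absorbed into the linear one. *)
exists (Num.min s0 1); first by rewrite lt_min s00 ltr01.
move=> s sgt0; rewrite le_min => /andP[/(H _ sgt0) h s1].
have : s * s * (d1 ^+ 2 + d2 ^+ 2) <= s * 1 * (d1 ^+ 2 + d2 ^+ 2).
  by rewrite ler_wpM2r ?addr_ge0 ?sqr_ge0// ler_wpM2l// ltW.
lra.
Qed.

(** The quadratic form is convex, hence lies above its linearization; so even on the boundary a
    direction with nonnegative first-order change needs no correction. *)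
Lemma ellipse_feasible (R : realType) (p q d1 d2 B : R) :
  B ^+ 2 <= B ^+ 2 * p ^+ 2 + q ^+ 2 ->
  (B ^+ 2 < B ^+ 2 * p ^+ 2 + q ^+ 2 \/ 0 <= B ^+ 2 * (p * d1) + q * d2) ->
  exists2 s0 : R, 0 < s0 & forall s, 0 < s -> s <= s0 ->
    B ^+ 2 <= B ^+ 2 * (p + s * d1) ^+ 2 + (q + s * d2) ^+ 2.
Proof.
move=> pqB; set G := B ^+ 2 * (p * d1) + q * d2.
have ineq s : B ^+ 2 * p ^+ 2 + q ^+ 2 + 2 * s * G <=
    B ^+ 2 * (p + s * d1) ^+ 2 + (q + s * d2) ^+ 2.
  rewrite -subr_ge0 [X in 0 <= X](_ : _ = (B * (s * d1)) ^+ 2 + (s * d2) ^+ 2).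
    by rewrite addr_ge0 ?sqr_ge0.
  by rewrite /G; ring.
move=> [pqB'|G0].
  have r0 : 0 < B ^+ 2 * p ^+ 2 + q ^+ 2 - B ^+ 2 by lra.
  have [s0 s00 H] := affine_pos_near0 _ _ (- 2 * G) r0.
  by exists s0 => // s sgt0 /(H _ sgt0); have := ineq s; lra.
exists 1 => // s s0 _; have : 0 <= s * G by rewrite mulr_ge0// ltW.
by have := ineq s; lra.
Qed.

Lemma normal_cone_moving_set (R : realType) (b : R -> R) (t : R)
    (x v : 'rV[R]_2) (d1 d2 : R) :
  0 < b t -> normal_cone (moving_set b t) x v ->
  (exists2 s0 : R, 0 < s0 & forall s, 0 < s -> s <= s0 ->
    (x 0 0 + s * d1 + 3 / 2) ^+ 2 + (x 0 1 + s * d2) ^+ 2 <= 1) ->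
  (exists2 s0 : R, 0 < s0 & forall s, 0 < s -> s <= s0 ->
    b t ^+ 2 <= b t ^+ 2 * (x 0 0 + s * d1) ^+ 2 + (x 0 1 + s * d2) ^+ 2) ->
  v 0 0 * d1 + v 0 1 * d2 <= 0.
Proof.
move=> bt0 xv [s1 s10 H1] [s2 s20 H2].
have := @normal_cone_feasible_direction _ _ _ _ (pt d1 d2) (Num.min s1 s2) xv.
rewrite !ptE lt_min s10 s20 => /(_ isT); apply => s s0.
rewrite le_min => /andP[/(H1 s s0) ss1 /(H2 s s0) ss2].
by split; [apply/ball1E|apply/(ellipse_exteriorE _ _ _ _ bt0)]; rewrite !mxE ?ptE.
Qed.

(** * Position of the moving set and inactivity of the circle *)

(** Eliminating [q ^+ 2] and replacing [B ^+ 2] by [7 / 2] leaves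
    [19 / 4 + 3 * p - 5 / 2 * p ^+ 2 <= 0], which fails between [-5/6] and [-1/2]. The bound [-5/6]
    is exactly what the circle argument below requires. *)
Lemma ball_ellipse_left (R : realType) (p q B : R) : 7 / 2 <= B ^+ 2 ->
  (p + 3 / 2) ^+ 2 + q ^+ 2 <= 1 -> B ^+ 2 <= B ^+ 2 * p ^+ 2 + q ^+ 2 ->
  p < - (5 / 6).
Proof.
move=> B2 ball ell; rewrite ltNge; apply/negP => p56.
have q2 := sqr_ge0 q.
have p12 : p <= - (1 / 2) by nra.
have : (B ^+ 2 - 7 / 2) * (1 - p ^+ 2) >= 0 by rewrite mulr_ge0; nra.
nra.
Qed.

Lemma ball_boundary_inactive (R : realType) (b : R -> R) (t alpha : R)
    (x v x' : 'rV[R]_2) :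
  0 < alpha -> 0 < b t -> 7 / 2 <= b t ^+ 2 ->
  moving_set b t x -> normal_cone (moving_set b t) x v ->
  - x' = v + alpha *: x ->
  ((x 0 0 + 3 / 2) ^+ 2 + x 0 1 ^+ 2 = 1 ->
   (x 0 0 + 3 / 2) * x' 0 0 + x 0 1 * x' 0 1 = 0) ->
  (x 0 0 + 3 / 2) ^+ 2 + x 0 1 ^+ 2 < 1.
Proof.
move=> a0 b0 b2 [/ball1E ball /(ellipse_exteriorE _ _ _ _ b0) ell] xv xE act.
rewrite lt_neqAle ball andbT; apply/eqP => ball1.
have left := ball_ellipse_left _ _ _ _ b2 ball ell.
have v0 : v 0 0 = - x' 0 0 - alpha * x 0 0.
  by have := congr1 (fun z : 'rV[R]_2 => z 0 0) xE; rewrite !mxE; lra.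
have v1 : v 0 1 = - x' 0 1 - alpha * x 0 1.
  by have := congr1 (fun z : 'rV[R]_2 => z 0 1) xE; rewrite !mxE; lra.
(* The test direction points to the centre of the disc. *)
have := normal_cone_moving_set _ _ _ _ _ (- (x 0 0 + 3 / 2)) (- x 0 1) b0 xv.
rewrite v0 v1; have := act ball1.
move: (x 0 0) (x 0 1) (x' 0 0) (x' 0 1) (b t) ball1 left b2 ball ell {act v0 v1 b0}.
move=> p q p' q' B ball1 left B2 ball ell act H.
have : (- p' - alpha * p) * - (p + 3 / 2) + (- q' - alpha * q) * - q <= 0.
  apply: H.
    exists 1 => // s s0 s1.
    have -> : (p + s * - (p + 3 / 2) + 3 / 2) ^+ 2 + (q + s * - q) ^+ 2 =
      (1 - s) ^+ 2 * ((p + 3 / 2) ^+ 2 + q ^+ 2) by ring.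
    by rewrite ball1 mulr1; nra.
  apply: ellipse_feasible => //.
  have [|e] := ltP (B ^+ 2) (B ^+ 2 * p ^+ 2 + q ^+ 2); [by left|right].
  have : B ^+ 2 * (p * - (p + 3 / 2)) + q * - q =
    B ^+ 2 * - (1 + 3 / 2 * p) + (B ^+ 2 - (B ^+ 2 * p ^+ 2 + q ^+ 2)) by ring.
  have : 0 <= B ^+ 2 * - (1 + 3 / 2 * p) by rewrite mulr_ge0; lra.
  lra.
(* By tangency the product of the normal vector with the inward direction is this quantity, positive
   since [p < - (5 / 6)]. *)
have : alpha * (p * (p + 3 / 2) + q ^+ 2) = alpha * (- (3 / 2) * p - 5 / 4).
  by congr (_ * _); lra.
have : 0 < alpha * (- (3 / 2) * p - 5 / 4) by rewrite mulr_gt0//; lra.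
lra.
Qed.

(** * Dissipation inequalities *)

(** With [W = (p + 1) ^+ 2 + q ^+ 2] the claim is [p + 1 <= 3 / 4 * W]. It is clear for [p <= -1];
    otherwise the ellipse forces [q ^+ 2 >= 7 / 2 * (1 + p) * (1 - p)]. *)
Lemma dissipation_free (R : realType) (p q B alpha : R) : 0 < alpha ->
  7 / 2 <= B ^+ 2 -> p < - (5 / 6) -> B ^+ 2 <= B ^+ 2 * p ^+ 2 + q ^+ 2 ->
  (p + 1) * - (alpha * p) + q * - (alpha * q) <=
    - (alpha / 4) * ((p + 1) ^+ 2 + q ^+ 2).
Proof.
move=> a0 B2 left ell.
have q2 := sqr_ge0 q; have p12 := sqr_ge0 (p + 1).
rewrite -subr_le0 [X in X <= 0](_ : _ =
  alpha * ((p + 1) - 3 / 4 * ((p + 1) ^+ 2 + q ^+ 2))); last by field.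
rewrite pmulr_rle0// subr_le0.
have [p1|p1] := leP p (-1); first lra.
have h1 : 0 <= (B ^+ 2 - 7 / 2) * ((1 + p) * (1 - p)) by rewrite !mulr_ge0; lra.
have h2 : 0 <= (1 + p) * (- p - 5 / 6) by rewrite mulr_ge0; lra.
lra.
Qed.

(* [v] is the normal component of the velocity [-(v + alpha x)]: it is parallel
   to the gradient [(p, q / B ^+ 2)], and its size is fixed by
   tangency to the moving ellipse. *)
Lemma dissipation_boundary (R : realType) (p q v1 v2 B B' alpha beta Lb : R) :
  0 < alpha -> 0 < beta -> beta <= B -> 7 / 2 <= beta ^+ 2 -> `|B'| <= Lb ->
  4 * Lb / (3 * beta ^+ 3) + 5 / 2 * alpha <= alpha * (beta ^+ 2 - 1) ->
  p < - (5 / 6) -> (p + 3 / 2) ^+ 2 + q ^+ 2 <= 1 ->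
  B ^+ 2 = B ^+ 2 * p ^+ 2 + q ^+ 2 ->
  B ^+ 2 * (p * (v1 + alpha * p)) + q * (v2 + alpha * q) = - (B' * q ^+ 2 / B) ->
  v1 * q = B ^+ 2 * p * v2 ->
  (p + 1) * - (v1 + alpha * p) + q * - (v2 + alpha * q) <=
    - (alpha / 4) * ((p + 1) ^+ 2 + q ^+ 2).
Proof.
move=> a0 be0 beB be2 BL hyp left ball ell tang par.
have B0 : 0 < B by exact: lt_le_trans beB.
have B2 : beta ^+ 2 <= B ^+ 2 by rewrite ler_pXn2r// nnegrE ltW.
have q2 := sqr_ge0 q.
have B2p : 0 < B ^+ 2 by rewrite exprn_gt0.
have p2 : p ^+ 2 <= 1.
  by rewrite -(ler_pM2l B2p) mulr1; lra.
have p1 : -1 <= p by nra.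
(* Since [p + 3 / 2 >= 1 / 2], the disc leaves at most [1 - 1 / 4]. *)
have q34 : q ^+ 2 <= 3 / 4 by nra.
(* [E] is minus half the time derivative of [q ^+ 2 / B ^+ 2] at fixed [q], and [G] is the squared
   length of [(p, q / B ^+ 2)]. The normal vector will be [- (E + alpha) / G] times that
   gradient. *)
pose E := B' * q ^+ 2 / B ^+ 3.
pose G := p ^+ 2 + q ^+ 2 / B ^+ 4.
have p34 : 3 / 4 <= p ^+ 2.
  have : 0 <= (B ^+ 2 - 7 / 2) * (1 - p ^+ 2) by rewrite mulr_ge0; lra.
  lra.
have G34 : 3 / 4 <= G.
  have : 0 <= q ^+ 2 / B ^+ 4 by rewrite divr_ge0// exprn_ge0// ltW.
  by rewrite /G; lra.
have G0 : 0 < G by lra.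
have q2E : q ^+ 2 = B ^+ 2 * (1 - p ^+ 2) by lra.
have T : p * v1 + q * v2 / B ^+ 2 = - (E + alpha).
  apply: (mulfI (lt0r_neq0 B2p)); rewrite /E.
  have -> : B ^+ 2 * (p * v1 + q * v2 / B ^+ 2) = B ^+ 2 * (p * v1) + q * v2.
    by field; lra.
  have -> : B ^+ 2 * - (B' * q ^+ 2 / B ^+ 3 + alpha) =
    - (B' * q ^+ 2 / B) - alpha * B ^+ 2 by field; lra.
  rewrite -tang [X in _ - alpha * X]ell; ring.
have v1E : v1 = - (E + alpha) / G * p.
  apply: (mulIf (lt0r_neq0 G0)); rewrite mulrAC divfK ?gt_eqF// -T /G.
  have -> : v1 * (p ^+ 2 + q ^+ 2 / B ^+ 4) = p * (p * v1) + v1 * q * (q / B ^+ 4).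
    by ring.
  by rewrite par; field; lra.
have v2E : v2 = - (E + alpha) / G * (q / B ^+ 2).
  apply: (mulIf (lt0r_neq0 G0)); rewrite mulrAC divfK ?gt_eqF// -T /G.
  have -> : v2 * (p ^+ 2 + q ^+ 2 / B ^+ 4) =
    p * (B ^+ 2 * p * v2) / B ^+ 2 + v2 * q ^+ 2 / B ^+ 4.
    by field; lra.
  by rewrite -par; field; lra.
(* Here [9 / 16] is [3 / 4] from [q34] times [3 / 4] from [hyp], which gives [Lb / beta ^+ 3 <= 3 /
   4 * alpha * (beta ^+ 2 - 7 / 2)]. *)
have EL : E <= 9 / 16 * alpha * (beta ^+ 2 - 7 / 2).
  have be3 : 0 < beta ^+ 3 by rewrite exprn_gt0.
  have : E <= 3 / 4 * (Lb / beta ^+ 3).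
    apply: le_trans (ler_norm _) _; rewrite /E normrM normfV normrM.
    rewrite (ger0_norm q2) (gtr0_norm (exprn_gt0 3 B0)) [_ * q ^+ 2]mulrC -[leLHS]mulrA.
    apply: ler_pM => //; first by rewrite divr_ge0// exprn_ge0// ltW.
    apply: ler_pM => //; first by rewrite invr_ge0 exprn_ge0// ltW.
    by rewrite lef_pV2 ?posrE ?exprn_gt0// ler_pXn2r// nnegrE ltW.
  have : 4 * Lb / (3 * beta ^+ 3) = 4 / 3 * (Lb / beta ^+ 3).
    by field; rewrite gt_eqF.
  lra.
have EG : (E + alpha) / G <= 4 / 3 * (9 / 16 * alpha * (beta ^+ 2 - 7 / 2) + alpha).
  rewrite ler_pdivrMr//.
  have X0 : 0 <= 9 / 16 * alpha * (beta ^+ 2 - 7 / 2) + alpha.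
    by rewrite addr_ge0// ?mulr_ge0//; lra.
  have := mulr_ge0 X0 (_ : 0 <= G - 3 / 4) => /(_ ltac:(lra)); lra.
(* On the ellipse [W] has the factor [p + 1 >= 0]. In the other factor the positive terms are at
   most [alpha * (3 / 4 * beta ^+ 2 - 7 / 24)], while [1 - p >= 3 / 2] makes the subtracted term at
   least [9 / 8 * alpha * beta ^+ 2]. *)
rewrite -subr_le0 [X in X <= 0](_ : _ =
  (p + 1) * (alpha + (E + alpha) / G - 3 / 4 * alpha * ((p + 1) + B ^+ 2 * (1 - p)))).
  apply: mulr_ge0_le0; first lra.
  have : 0 <= alpha * (B ^+ 2 * (1 - p - 3 / 2)) by rewrite !mulr_ge0; lra.
  have : 0 <= alpha * (B ^+ 2 - beta ^+ 2) by rewrite mulr_ge0; lra.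
  have : 0 <= alpha * (p + 1) by rewrite mulr_ge0; lra.
  have : 0 <= alpha * (beta ^+ 2 - 7 / 2) by rewrite mulr_ge0; lra.
  lra.
rewrite v1E v2E; set F := (E + alpha) / G.
rewrite -/F !mulNr -/F.
have -> : q * - (- (F * (q / B ^+ 2)) + alpha * q) = q ^+ 2 * (F / B ^+ 2 - alpha).
  by field; lra.
rewrite q2E; field; lra.
Qed.

(** * Differentiation along a solution *)

Lemma is_derive_coord (R : realType) (x : R -> 'rV[R]_2) (t : R) (j : 'I_2) :
  derivable x t 1 -> is_derive t 1 (fun s => x s 0 j) (derive1 x t 0 j).
Proof.
move=> dx; have dxj : derivable (fun s => x s 0 j) t 1 by move/derivable_mxP: dx.
apply: (DeriveDef dxj); by rewrite derive1E derive_mx// mxE.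
Qed.

(** Used with [c = 3 / 2] for the circle and [c = 1] for the distance to the equilibrium. *)
Lemma is_derive_sqr_dist (R : realType) (x : R -> 'rV[R]_2) (t c : R) :
  derivable x t 1 ->
  is_derive t 1 (fun s => (x s 0 0 + c) ^+ 2 + x s 0 1 ^+ 2)
    (2 * ((x t 0 0 + c) * derive1 x t 0 0 + x t 0 1 * derive1 x t 0 1)).
Proof.
move=> dx; have d0 := is_derive_coord _ x t 0 dx; have d1 := is_derive_coord _ x t 1 dx.
rewrite (_ : (fun s => _) = ((fun s => x s 0 0) + cst c) ^+ 2 + (fun s => x s 0 1) ^+ 2)//.
by apply: is_derive_eq; rewrite /GRing.scale/= ?expr1 ?fctE/=; ring.
Qed.

(** The sign makes the function nonpositive on feasible points, so that activity means a maximum. *)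
Lemma is_derive_ellipse (R : realType) (b : R -> R) (x : R -> 'rV[R]_2) (t : R) :
  derivable b t 1 -> derivable x t 1 ->
  is_derive t 1 (fun s => b s ^+ 2 - (b s ^+ 2 * x s 0 0 ^+ 2 + x s 0 1 ^+ 2))
    (2 * (b t * 'D_1 b t * (1 - x t 0 0 ^+ 2)
          - (b t ^+ 2 * (x t 0 0 * derive1 x t 0 0) + x t 0 1 * derive1 x t 0 1))).
Proof.
move=> /derivableP db dx.
have d0 := is_derive_coord _ x t 0 dx; have d1 := is_derive_coord _ x t 1 dx.
rewrite (_ : (fun s => _) =
  b ^+ 2 - (b ^+ 2 * (fun s => x s 0 0) ^+ 2 + (fun s => x s 0 1) ^+ 2))//.
by apply: is_derive_eq; rewrite /GRing.scale/= ?expr1 ?fctE/=; ring.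
Qed.

Lemma sweeping_dissipation (R : realType) (alpha beta Lb : R) (b : R -> R)
    (x : R -> 'rV[R]_2) (t d : R) :
  0 < alpha -> 1 < beta -> (forall s, beta <= b s) -> derivable b t 1 ->
  (forall t1 t2 : R, `|b t1 - b t2| <= Lb * `|t1 - t2|) ->
  7 / 2 <= beta ^+ 2 ->
  4 * Lb / (3 * beta ^+ 3) + 5 / 2 * alpha <= alpha * (beta ^+ 2 - 1) ->
  0 < d -> (forall s, `|s - t| < d -> moving_set b s (x s)) ->
  derivable x t 1 ->
  [set v + alpha *: x t | v in normal_cone (moving_set b t) (x t)] (- derive1 x t) ->
  (x t 0 0 + 1) * derive1 x t 0 0 + x t 0 1 * derive1 x t 0 1 <=
    - (alpha / 4) * ((x t 0 0 + 1) ^+ 2 + x t 0 1 ^+ 2).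
Proof.
move=> a0 be1 beb db bL be2 hyp d0 Cx dx [v xv vE].
have b0 s : 0 < b s by apply: lt_le_trans (beb s); lra.
have b2 s : 7 / 2 <= b s ^+ 2.
  by apply: le_trans be2 _; rewrite ler_pXn2r// nnegrE ltW//; lra.
have Ct : moving_set b t (x t) by apply: Cx; rewrite subrr normr0.
have [/ball1E ball /(ellipse_exteriorE _ _ _ _ (b0 t)) ell] := Ct.
have left := ball_ellipse_left _ _ _ _ (b2 t) ball ell.
have ball_tangent : (x t 0 0 + 3 / 2) ^+ 2 + x t 0 1 ^+ 2 = 1 ->
   (x t 0 0 + 3 / 2) * derive1 x t 0 0 + x t 0 1 * derive1 x t 0 1 = 0.
  move=> e; have [df df0] := is_derive_sqr_dist _ x t (3 / 2) dx.
  have := derive_local_max _ _ _ _ df d0.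
  rewrite df0 => /(_ _)/eqP; rewrite mulf_eq0 pnatr_eq0/= => H; apply/eqP/H => s sd.
  by have [/ball1E] := Cx s sd; rewrite e.
have ball_lt := ball_boundary_inactive _ _ _ _ _ _ _
  a0 (b0 t) (b2 t) Ct xv (esym vE) ball_tangent.
have x1 : derive1 x t 0 0 = - (v 0 0 + alpha * x t 0 0).
  by have := congr1 (fun z : 'rV[R]_2 => z 0 0) vE; rewrite !mxE; lra.
have x2 : derive1 x t 0 1 = - (v 0 1 + alpha * x t 0 1).
  by have := congr1 (fun z : 'rV[R]_2 => z 0 1) vE; rewrite !mxE; lra.
have vdir d1 d2 : b t ^+ 2 < b t ^+ 2 * x t 0 0 ^+ 2 + x t 0 1 ^+ 2 \/
      0 <= b t ^+ 2 * (x t 0 0 * d1) + x t 0 1 * d2 ->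
    v 0 0 * d1 + v 0 1 * d2 <= 0.
  move=> dir; apply: normal_cone_moving_set (b0 t) xv _ _.
    exact: ball_feasible.
  exact: ellipse_feasible.
have [lt|ge] := ltP (b t ^+ 2) (b t ^+ 2 * x t 0 0 ^+ 2 + x t 0 1 ^+ 2).
  (* Off both boundaries [v] is itself a feasible direction, so its squared length is
     nonpositive. *)
  have /(_ (or_introl lt)) := vdir (v 0 0) (v 0 1).
  rewrite -!expr2 => v0.
  have /eqP : v 0 0 ^+ 2 = 0 by have := sqr_ge0 (v 0 0); have := sqr_ge0 (v 0 1); lra.
  have /eqP : v 0 1 ^+ 2 = 0 by have := sqr_ge0 (v 0 0); have := sqr_ge0 (v 0 1); lra.
  rewrite !sqrf_eq0 => /eqP v2 /eqP v1.
  rewrite x1 x2 v1 v2 !add0r.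
  exact: dissipation_free (b2 t) left ell.
have {ell ge} ell : b t ^+ 2 = b t ^+ 2 * x t 0 0 ^+ 2 + x t 0 1 ^+ 2 by apply/le_anti/andP.
have DL : `|'D_1 b t| <= Lb by apply: derive_lipschitz => // s; exact: bL.
have tangent : b t * 'D_1 b t * (1 - x t 0 0 ^+ 2)
    = b t ^+ 2 * (x t 0 0 * derive1 x t 0 0) + x t 0 1 * derive1 x t 0 1.
  have [df df0] := is_derive_ellipse _ b x t db dx.
  have := derive_local_max _ _ _ _ df d0.
  rewrite df0 => /(_ _)/eqP; rewrite mulf_eq0 pnatr_eq0/= subr_eq0 => H; apply/eqP/H => s sd.
  by have [_ /(ellipse_exteriorE _ _ _ _ (b0 s))] := Cx s sd; rewrite -ell; lra.
rewrite x1 x2 in tangent *.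
apply: (dissipation_boundary _ _ _ _ _ _ _ _ _ _ a0 _ (beb t)
  be2 DL hyp left ball ell); first lra.
- have -> : b t ^+ 2 * (x t 0 0 * (v 0 0 + alpha * x t 0 0)) +
      x t 0 1 * (v 0 1 + alpha * x t 0 1)
    = - (b t * 'D_1 b t * (1 - x t 0 0 ^+ 2)) by rewrite tangent; ring.
  have -> : x t 0 1 ^+ 2 = b t ^+ 2 * (1 - x t 0 0 ^+ 2) by lra.
  by field; rewrite gt_eqF.
(* Both directions tangent to the ellipse are feasible, so [v] is orthogonal to them. *)
- have := vdir (x t 0 1) (- (b t ^+ 2 * x t 0 0)) (or_intror _).
  have := vdir (- x t 0 1) (b t ^+ 2 * x t 0 0) (or_intror _).
  move=> /(_ ltac:(lra)) h1 /(_ ltac:(lra)) h2; lra.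
Qed.

(** * Polynomial form of the hypothesis *)

(** In terms of the cube root [c] of [beta], [beta ^+ 2 - 1 = X * c ^+ 2]. Squaring reduces
    [Y <= beta ^+ 2 - 1] to [X <= c ^+ 4]. *)
Lemma gap_bound (R : realType) (alpha beta Lb : R) :
  0 < alpha -> 1 < beta -> 0 <= Lb ->
  (4 * Lb / (3 * beta ^+ 3) + 5 / 2 * alpha) /
    (beta `^ (4 / 3) - beta `^ (- (2 / 3))) `^ (3 / 2) < alpha ->
  4 * Lb / (3 * beta ^+ 3) + 5 / 2 * alpha <= alpha * (beta ^+ 2 - 1).
Proof.
move=> a0 be1 L0.
have be0 : 0 < beta by lra.
set c := beta `^ (1 / 3).
have c0 : 0 < c by rewrite powR_gt0.
have cE (n : nat) : c ^+ n = beta `^ (n%:R / 3).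
  by rewrite -powR_mulrn ?ltW// -powRrM; congr (_ `^ _); field.
have -> : beta `^ (4 / 3) = c ^+ 4 by rewrite cE.
have -> : beta `^ (- (2 / 3)) = (c ^+ 2)^-1 by rewrite powRN cE.
have beE : beta = c ^+ 3 by rewrite cE divff// powRr1// ltW.
set X := c ^+ 4 - _.
have c1 : 1 < c by rewrite -(@ltr_pXn2r _ 3)// ?nnegrE ?ltW// expr1n -beE.
have c20 : 0 < c ^+ 2 by rewrite exprn_gt0.
have XE : X * c ^+ 2 = beta ^+ 2 - 1.
  by rewrite /X beE; field; lra.
have b21 : 0 < beta ^+ 2 - 1 by rewrite subr_gt0 exprn_egt1.
have X0 : 0 < X by rewrite -(pmulr_lgt0 _ c20) XE.
set Y := X `^ _.
have Y0 : 0 < Y by rewrite powR_gt0.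
have Y2 : Y ^+ 2 = X ^+ 3.
  rewrite -powR_mulrn ?ltW// -powRrM divfK ?pnatr_eq0//.
  by rewrite (powR_mulrn 3) ?ltW.
have Yle : Y <= beta ^+ 2 - 1.
  rewrite -(@ler_pXn2r _ 2) ?nnegrE ?(ltW Y0) ?(ltW b21)// Y2 -XE.
  rewrite exprMn [leLHS]exprSr; apply: ler_wpM2l; first by rewrite exprn_ge0// ltW.
  rewrite -(ler_pM2r c20) XE.
  have -> : (c ^+ 2) ^+ 2 * c ^+ 2 = beta ^+ 2 by rewrite beE; ring.
  lra.
rewrite ltr_pdivrMr// => /ltW h; apply: le_trans h _.
by rewrite ler_pM2l.
Qed.

(** * Equilibrium, decay and stability *)

Lemma global_solution_equilibrium (R : realType) (alpha : R) (b : R -> R) :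
  0 < alpha -> (forall t, 1 <= b t) ->
  global_solution (moving_set b) (fun (_ : R) (x : 'rV[R]_2) => alpha *: x)
    (fun=> pt (-1) 0).
Proof.
move=> a0 b1.
have b0 t : 0 < b t by apply: lt_le_trans (b1 t).
have C0 t : moving_set b t (pt (-1) 0).
  split; first by apply/ball1E; rewrite !ptE; lra.
  by apply/(ellipse_exteriorE _ _ _ _ (b0 t)); rewrite !ptE; lra.
split.
- move=> c d _ _ e e0; exists 1 => // n s t _ _ _.
  rewrite big1// => i _; apply/eqP.
  by rewrite -sqrf_eq0 sqr_enorm !mxE !subrr expr0n addr0.
- by move=> t _; exact: C0.
- apply: aeW => t _; split; first exact: derivable_cst.
  exists (- (alpha *: pt (-1) 0)); last first.
    by rewrite addNr derive1_cst oppr0.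
  (* This scale moves the shifted point to the origin, whose distance to the set is 1 because
     [b t >= 1]. *)
  exists alpha^-1; first by rewrite invr_gt0.
  have -> : pt (-1) 0 + alpha^-1 *: - (alpha *: pt (-1) 0) = 0 :> 'rV[R]_2.
    by rewrite scalerN scalerA mulVf ?gt_eqF// scale1r subrr.
  split=> // z [_ /(ellipse_exteriorE _ _ _ _ (b0 t)) ell].
  rewrite !sub0r ler_enorm !mxE/= !sqrrN expr1n expr0n addr0.
  have B1 : 1 <= b t ^+ 2 by rewrite exprn_ege1.
  have B0 : 0 < b t ^+ 2 by rewrite exprn_gt0.
  rewrite -(ler_pM2l B0) mulr1; apply: le_trans ell _.
  rewrite mulrDr lerD2l -[leLHS]mul1r; apply: ler_wpM2r => //.
  exact: sqr_ge0.
Qed.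

(** The rate [k] is left free: zero gives monotonicity, a negative value gives attraction. *)
Lemma sqr_dist_decay (R : realType) (alpha beta Lb : R) (b : R -> R)
    (x : R -> 'rV[R]_2) (tau s t k : R) :
  0 < alpha -> 1 < beta -> (forall r, derivable b r 1) -> (forall r, beta <= b r) ->
  (forall t1 t2 : R, `|b t1 - b t2| <= Lb * `|t1 - t2|) ->
  7 / 2 <= beta ^+ 2 ->
  4 * Lb / (3 * beta ^+ 3) + 5 / 2 * alpha <= alpha * (beta ^+ 2 - 1) ->
  sweeping_solution (moving_set b) (fun _ z => alpha *: z) `[tau, +oo[ x ->
  tau <= s -> s <= t ->
  (forall r, s < r < t -> - (alpha / 2) * enorm (x r - pt (-1) 0) ^+ 2 <= k) ->
  enorm (x t - pt (-1) 0) ^+ 2 - enorm (x s - pt (-1) 0) ^+ 2 <= k * (t - s).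
Proof.
move=> a0 be1 db beb bL be2 hyp [acx Cx aex] taus st kb.
pose W r := (x r 0 0 + 1) ^+ 2 + x r 0 1 ^+ 2.
have WE r : enorm (x r - pt (-1) 0) ^+ 2 = W r.
  by rewrite sqr_enorm !mxE/= opprK subr0.
rewrite !WE.
have acst : absolutely_continuous s t x.
  apply: acx => // r /=; rewrite !in_itv/= andbT => /andP[sr _].
  exact: le_trans sr.
have ball r : tau <= r -> (x r 0 0 + 3 / 2) ^+ 2 + x r 0 1 ^+ 2 <= 1.
  by move=> taur; have [/ball1E] := Cx r ltac:(by rewrite in_itv/= taur).
(* On the disc [x_1 + 1] and [x_2] are at most 2 in absolute value, so each square contributes a
   Lipschitz constant 4. *)
apply: (@ac_mean_value R x W s t 8) => //.
  move=> u v /andP[su _] /andP[sv _].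
  have bu := ball u (le_trans taus su); have bv := ball v (le_trans taus sv).
  have [] := normr_le_enorm _ (x v - x u); rewrite !mxE.
  have bound r : (x r 0 0 + 3 / 2) ^+ 2 + x r 0 1 ^+ 2 <= 1 ->
      `|x r 0 0 + 1| <= 2 /\ `|x r 0 1| <= 2.
    move=> h; rewrite !ler_norml.
    have := sqr_ge0 (x r 0 0 + 3 / 2); have := sqr_ge0 (x r 0 1) => h1 h2.
    by split; nra.
  have [bu0 bu1] := bound u bu; have [bv0 bv1] := bound v bv.
  have prod (y z e : R) : `|y| <= 2 -> `|z| <= 2 ->
      `|y - z| <= e -> `|y ^+ 2 - z ^+ 2| <= 4 * e.
    move=> hy hz hyz; rewrite subr_sqr normrM mulrC ler_pM//.
    by apply: le_trans (ler_normD _ _) _; lra.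
  have e0 : x v 0 0 - x u 0 0 = (x v 0 0 + 1) - (x u 0 0 + 1) by ring.
  rewrite e0 => /(prod _ _ _ bv0 bu0) h0 /(prod _ _ _ bv1 bu1) h1.
  rewrite /W opprD addrACA; apply: le_trans (ler_normD _ _) _; lra.
apply: (@filterS _ _ (ae_filter_ringOfSetsType _)) aex => r Hr /andP[sr rt].
have taur : tau < r by lra.
have [dx incl] := Hr ltac:(by rewrite in_itv/= ltW).
have [dW DW] := is_derive_sqr_dist _ x r 1 dx.
split; first exact: dW.
rewrite DW; have := kb r ltac:(by rewrite sr); rewrite WE.
(* Since [r > tau], feasibility holds on both sides of [r], as the tangency argument needs. *)
have d0 : 0 < r - tau by rewrite subr_gt0.
have Cxr u : `|u - r| < r - tau -> moving_set b u (x u).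
  by rewrite ltr_norml => /andP[? _]; apply: Cx; rewrite in_itv/= andbT; lra.
have := sweeping_dissipation _ _ _ _ _ _ _ _ a0 be1 beb (db r) bL be2 hyp d0 Cxr dx incl.
by rewrite /W; lra.
Qed.

Theorem proposition1 (R : realType) (alpha beta Lb : R) (b : R -> R)
    (alpha_gt0 : 0 < alpha) (beta_gt1 : 1 < beta)
    (b_derivable : forall t : R, derivable b t 1)
    (b_C1 : continuous (derive1 b))
    (b_ge : forall t : R, beta <= b t)
    (Lb_ge0 : 0 <= Lb)
    (b_lip : forall t1 t2 : R, `|b t1 - b t2| <= Lb * `|t1 - t2|)
    (alpha_gt :
       (4 * Lb / (3 * beta ^+ 3) + 5 / 2 * alpha) /
         (beta `^ (4 / 3) - beta `^ (- (2 / 3))) `^ (3 / 2) < alpha) :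
  let C := moving_set b in
  let f := fun (_ : R) (x : 'rV[R]_2) => alpha *: x in
  let x0 := fun _ : R => pt (-1) 0 in
  global_solution C f x0 /\ globally_asymptotically_stable C f x0.
Proof.
move=> C f x0.
have hyp := gap_bound _ _ _ _ alpha_gt0 beta_gt1 Lb_ge0 alpha_gt.
have be2 : 7 / 2 <= beta ^+ 2.
  rewrite -subr_ge0 -(pmulr_rge0 _ alpha_gt0).
  have : 0 <= 4 * Lb / (3 * beta ^+ 3).
    by rewrite divr_ge0 ?mulr_ge0 ?exprn_ge0//; lra.
  lra.
have decay x tau s t k := @sqr_dist_decay R alpha beta Lb b x tau s t k
  alpha_gt0 beta_gt1 b_derivable b_ge b_lip be2 hyp.
have mono tau x : sweeping_solution C f `[tau, +oo[ x ->
    forall s t, tau <= s -> s <= t -> enorm (x t - x0 t) <= enorm (x s - x0 s).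
  move=> sol s t taus st.
  rewrite -(@ler_pXn2r _ 2) ?nnegrE ?enorm_ge0// -subr_le0 -[leRHS](mul0r (t - s)).
  apply: (decay x tau) => // r _.
  by rewrite mulNr oppr_le0 mulr_ge0 ?sqr_ge0//; lra.
split; first by apply: global_solution_equilibrium => // t; apply: le_trans (b_ge t); lra.
split.
  move=> tau eps eps0; exists eps => // x sol xtau t taut.
  by apply: le_lt_trans xtau; exact: mono sol _ _ _ _.
move=> tau x sol; apply/cvgrPdist_lt => e e0.
suff [s taus xs] : exists2 s, tau <= s & enorm (x s - x0 s) < e.
  exists s; split; first exact: num_real.
  move=> t st; rewrite /= sub0r normrN ger0_norm ?enorm_ge0//.
  by apply: le_lt_trans xs; apply: mono sol _ _ _ _ => //; exact: ltW.
apply: contrapT => /forall2NP far.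
have {}far s : tau <= s -> e <= enorm (x s - x0 s).
  by move=> taus; case: (far s) => // /negP; rewrite -leNgt.
set k := alpha / 2 * e ^+ 2.
have k0 : 0 < k by rewrite mulr_gt0 ?exprn_gt0//; lra.
set W0 := enorm (x tau - x0 tau) ^+ 2.
have W00 : 0 <= W0 by exact: sqr_ge0.
(* After time [W0 / k + 1], decay at rate [k] would bring the squared distance to at most
   [- k < 0]. *)
have T0 : 0 <= W0 / k + 1 by rewrite addr_ge0// divr_ge0// ltW.
have := decay x tau tau (tau + (W0 / k + 1)) (- k) sol (lexx _) ltac:(by rewrite lerDl).
have -> : - k * (tau + (W0 / k + 1) - tau) = - W0 - k by field; rewrite gt_eqF.
rewrite -/W0 => H.
have := sqr_ge0 (enorm (x (tau + (W0 / k + 1)) - pt (-1) 0)).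
suff : enorm (x (tau + (W0 / k + 1)) - pt (-1) 0) ^+ 2 - W0 <= - W0 - k by lra.
apply: H => r /andP[/ltW taur _].
rewrite mulNr lerN2 ler_pM2l; last lra.
by rewrite ler_pXn2r ?nnegrE ?enorm_ge0 ?(ltW e0)//; exact: far.
Qed.
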